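(* Let $S,\mathcal Z,h^{\mathcal Z},R,g_R$ be as in the context. Let $U\subset S$ be open, let $(N,h^N)$ be a Riemannian manifold, let $\Theta:U\to N$ be a smooth map, and suppose there is a vector-bundle isomorphism $\Psi:\mathcal Z|_U\to\Theta^*TN$ with $\Psi\circ R=d\Theta$. Suppose that $(g_R)_p$ is positive definite at some $p\in U$. Fix auxiliary Riemannian metrics on $S$ and on $N$, and let $d_S$ and $d_N$ denote the corresponding distance functions. Then there exist a neighbourhood $U_0\subset U$ of $p$ and a constant $C>0$ such that $$d_S(p_1,p_2)\le C\,d_N\bigl(\Theta(p_1),\Theta(p_2)\bigr)\qquad\text{for all }p_1,p_2\in U_0.$$
   Context: $S$ is a smooth finite-dimensional manifold parameterizing a smooth family $\{g_p\}_{p\in S}$ of normalized Einstein metrics on a fixed smooth manifold $M$. The family comes with the following given data: a smooth real vector bundle $\mathcal Z\to S$ of finite rank (the observation bundle), a smooth positive-definite fibre metric $h^{\mathcal Z}$ on $\mathcal Z$, and a smooth vector bundle morphism $R:TS\to\mathcal Z$ over the identity of $S$, with fibre maps $R_p:T_pS\to\mathcal Z_p$. The response metric is $g_R=R^*h^{\mathcal Z}$, i.e. $(g_R)_p(X,Y)=h^{\mathcal Z}_p(R_pX,R_pY)$. All manifolds, bundles and bundle maps are smooth. No compatibility between $h^{\mathcal Z}$ and $h^N$ is assumed. *)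

(* Defs.v *)
From HB Require Import structures.
From mathcomp Require Import all_boot all_order all_algebra.
From mathcomp Require Import all_classical all_reals all_analysis.

Set Implicit Arguments.
Unset Strict Implicit.
Unset Printing Implicit Defensive.

Import Order.TTheory GRing.Theory Num.Theory.
Import numFieldNormedType.Exports.

Local Open Scope classical_set_scope.
Local Open Scope ring_scope.

(* [U] is meant to be open. In finite dimension this is the usual C^k: by the formula
   'd f x v = 'D_v f x, differentiability together with C^k directional
   derivatives amounts to the total derivative being C^k. *)
Section Smooth.
Context {R : realType} {V W : normedModType R}.

Fixpoint Ck_on (k : nat) (U : set V) (f : V -> W) : Prop :=
  match k with
  | 0 => forall x, U x -> {for x, continuous f}
  | k'.+1 => (forall x, U x -> differentiable f x) /\
             (forall v : V, Ck_on k' U (fun x => 'D_v f x))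
  end.

Definition smooth_on (U : set V) (f : V -> W) : Prop :=
  forall k, Ck_on k U f.

End Smooth.

Section SmoothFacts.
Context {R : realType}.

Lemma Ck_cont (V W : normedModType R) k (U : set V) (f : V -> W) :
  Ck_on k U f -> forall x, U x -> {for x, continuous f}.
Proof.
case: k => [//|k [df _]] x Ux; exact/differentiable_continuous/df.
Qed.

Lemma CkW (V W : normedModType R) k (U : set V) (f : V -> W) :
  Ck_on k.+1 U f -> Ck_on k U f.
Proof.
elim: k f => [|k IH] f H; first exact: Ck_cont H.
by case: H => df Df; split => // v; apply: IH; exact: Df.
Qed.

Lemma Ck_sub (V W : normedModType R) k (U U' : set V) (f : V -> W) :
  U' `<=` U -> Ck_on k U f -> Ck_on k U' f.
Proof.
move=> sUU'; elim: k f => [|k IH] f /=; first by move=> H x /sUU'; exact: H.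
by case=> df Df; split => [x /sUU'|v]; [exact: df|exact: IH].
Qed.

Lemma near_eq_differentiable (V W : normedModType R) (f g : V -> W) (x : V) :
  (\near x, f x = g x) -> differentiable f x -> differentiable g x.
Proof.
move=> fg df.
have [cd dE] := (diff_locallyP _ _).1 df.
have gE : g \o shift x = cst (g x) + 'd f x +o_ 0 id.
  apply/eqaddoP => e e0; move/eqaddoP : dE => /(_ e e0) dE.
  have fg0 : \forall h \near 0, f (h + x) = g (h + x).
    by move: fg; rewrite (near_shift 0 x) /=; apply: filterS => h /=; rewrite subr0.
  by apply: filterS2 dE fg0 => h; rewrite !fctE /= (nbhs_singleton fg) => + <-.
apply/diff_locallyP; have := diff_unique cd gE => ->.
by split.
Qed.

Lemma Ck_eq (V W : normedModType R) k (U : set V) (f g : V -> W) :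
  open U -> (forall x, U x -> f x = g x) -> Ck_on k U f -> Ck_on k U g.
Proof.
move=> oU; elim: k f g => [|k IH] f g fg /=.
  move=> H x Ux; apply: cvg_trans (_ : f @ x --> g x).
    by apply: near_eq_cvg; apply: filterS (open_nbhs_nbhs (conj oU Ux)) => y /fg.
  by rewrite -fg //; exact: H.
have nfg x : U x -> \near x, f x = g x.
  by move=> Ux; apply: filterS (open_nbhs_nbhs (conj oU Ux)) => y /fg.
case=> df Df; split => [x Ux|v].
  by apply: near_eq_differentiable (df x Ux); exact: nfg.
by apply: IH (Df v) => x Ux; apply: near_eq_derive; exact: nfg.
Qed.

Lemma Ck_cst (V W : normedModType R) k (U : set V) (c : W) :
  Ck_on k U (fun _ => c).
Proof.
elim: k c => [|k IH] c /=; first by move=> x _; exact: cst_continuous.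
split=> [x _|v]; first exact: differentiable_cst.
have -> : (fun x : V => 'D_v (fun=> c) x) = fun=> 0 by
  apply/funext => x; exact: (@derive_cst _ V W c x v).
exact: IH.
Qed.

Lemma Ck_add (V W : normedModType R) k (U : set V) (f g : V -> W) :
  open U -> Ck_on k U f -> Ck_on k U g -> Ck_on k U (fun x => f x + g x).
Proof.
move=> oU; elim: k f g => [|k IH] f g /=.
  by move=> cf cg x Ux; apply: cvgD; [exact: cf|exact: cg].
move=> [df Df] [dg Dg]; split=> [x Ux|v].
  exact: differentiableD (df x Ux) (dg x Ux).
apply: Ck_eq (IH _ _ (Df v) (Dg v)) => // x Ux.
by rewrite [RHS]deriveD //; apply: diff_derivable; [exact: df|exact: dg].
Qed.

Lemma Ck_sum (V W : normedModType R) k (U : set V) n (f : 'I_n -> V -> W) :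
  open U -> (forall i, Ck_on k U (f i)) -> Ck_on k U (fun x => \sum_i f i x).
Proof.
move=> oU; elim: n f => [|n IH] f H.
  by apply: Ck_eq (Ck_cst k U 0) => // x _; rewrite big_ord0.
apply: Ck_eq (Ck_add oU (H ord0) (IH (fun i => f (lift ord0 i)) _)) => //.
by move=> x _; rewrite big_ord_recl.
Qed.

Lemma Ck_mul (V : normedModType R) k (U : set V) (f g : V -> R^o) :
  open U -> Ck_on k U f -> Ck_on k U g -> Ck_on k U (fun x => f x * g x : R^o).
Proof.
move=> oU; elim: k f g => [|k IH] f g.
  by move=> cf cg x Ux; apply: cvgM; [exact: cf|exact: cg].
move=> Cf Cg; have [df Df] := Cf; have [dg Dg] := Cg; split=> [x Ux|v].
  exact: differentiableM (df x Ux) (dg x Ux).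
apply: Ck_eq (Ck_add oU (IH _ _ (CkW Cf) (Dg v)) (IH _ _ (CkW Cg) (Df v))) => //.
move=> x Ux; rewrite [RHS]deriveM //; apply: diff_derivable;
  [exact: df|exact: dg].
Qed.

Lemma Ck_lin (V W W' : normedModType R) k (U : set V) (L : {linear W -> W'})
    (f : V -> W) :
  open U -> continuous L -> Ck_on k U f -> Ck_on k U (fun x => L (f x)).
Proof.
move=> oU cL; elim: k f => [|k IH] f /=.
  by move=> cf x Ux; apply: (@continuous_comp _ _ _ f L); [exact: cf|exact: cL].
move=> [df Df]; have dLf x : U x -> differentiable (L \o f) x.
  by move=> Ux; apply: differentiable_comp; [exact: df|exact: linear_differentiable].
split=> [x Ux|v]; first exact: dLf.
apply: Ck_eq (IH _ (Df v)) => // x Ux.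
rewrite [RHS](deriveE _ (dLf x Ux)) diff_comp; first last.
- exact: linear_differentiable.
- exact: df.
by rewrite /= diff_lin // deriveE //; exact: df.
Qed.

Lemma Ck_coord (V : normedModType R) k n (U : set V) (f : V -> 'rV[R]_n) i :
  open U -> Ck_on k U f -> Ck_on k U (fun x => f x ord0 i : R^o).
Proof.
move=> oU; have lin : linear (fun M : 'rV[R]_n => M ord0 i : R^o).
  by move=> a u v; rewrite !mxE.
pose LM := GRing.isLinear.Build _ _ _ _ _ lin.
pose L : {linear 'rV[R]_n -> R^o} :=
  HB.pack (fun M : 'rV[R]_n => M ord0 i : R^o) LM.
by apply: (@Ck_lin _ _ _ k U L) => //; exact: coord_continuous.
Qed.

Lemma Ck_scale_cst (V W : normedModType R) k (U : set V) (f : V -> R^o) (w : W) :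
  open U -> Ck_on k U f -> Ck_on k U (fun x => f x *: w).
Proof.
move=> oU; have lin : linear (fun a : R^o => a *: w).
  by move=> a u v; rewrite scalerDl scalerA.
pose LM := GRing.isLinear.Build _ _ _ _ _ lin.
pose L : {linear R^o -> W} := HB.pack (fun a : R^o => a *: w) LM.
by apply: (@Ck_lin _ _ _ k U L) => //; exact: scalel_continuous.
Qed.

Lemma Ck_rV (V : normedModType R) k n (U : set V) (f : V -> 'rV[R]_n) :
  open U -> (forall i, Ck_on k U (fun x => f x ord0 i : R^o)) -> Ck_on k U f.
Proof.
move=> oU H.
apply: Ck_eq (Ck_sum oU (fun i => Ck_scale_cst (delta_mx 0 i) oU (H i))) => //.
by move=> x _; rewrite -row_sum_delta.
Qed.

Lemma Ck_comp_scalar (V : normedModType R) k n (U : set V) (U' : set 'rV[R]_n)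
    (f : V -> 'rV[R]_n) (g : 'rV[R]_n -> R^o) :
  open U -> (forall x, U x -> U' (f x)) ->
  Ck_on k U f -> Ck_on k U' g -> Ck_on k U (fun x => g (f x)).
Proof.
move=> oU UU'; elim: k g => [|k IH] g.
  by move=> cf cg x Ux; apply: (@continuous_comp _ _ _ f g);
    [exact: cf|exact/cg/UU'].
move=> Cf; have [df Df] := Cf => -[dg Dg].
have dgf x : U x -> differentiable (g \o f) x.
  by move=> Ux; apply: differentiable_comp; [exact: df|apply: dg; exact: UU'].
split=> [x Ux|v]; first exact: dgf.
pose D i x := 'D_v f x ord0 i * 'D_(delta_mx 0 i) g (f x) : R^o.
have CD i : Ck_on k U (D i).
  by apply: Ck_mul => //; [exact/Ck_coord/Df|apply: IH (CkW Cf) (Dg _)].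
apply: Ck_eq (Ck_sum oU CD) => // x Ux.
rewrite [RHS](deriveE _ (dgf x Ux)) diff_comp; first last.
- by apply: dg; exact: UU'.
- exact: df.
rewrite /= -(deriveE _ (df x Ux)) [in RHS](row_sum_delta ('D_v f x)) linear_sum.
by apply: eq_bigr => i _; rewrite linearZ /D (deriveE _ (dg _ (UU' _ Ux))).
Qed.

Lemma smooth_comp (V : normedModType R) n m (U : set V) (U' : set 'rV[R]_n)
    (f : V -> 'rV[R]_n) (g : 'rV[R]_n -> 'rV[R]_m) :
  open U -> (forall x, U x -> U' (f x)) -> open U' ->
  smooth_on U f -> smooth_on U' g -> smooth_on U (fun x => g (f x)).
Proof.
move=> oU UU' oU' sf sg k; apply: Ck_rV => // i.
by apply: Ck_comp_scalar (sf k) (Ck_coord i oU' (sg k)).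
Qed.

Lemma smooth_eq (V W : normedModType R) (U : set V) (f g : V -> W) :
  open U -> (forall x, U x -> f x = g x) -> smooth_on U f -> smooth_on U g.
Proof. by move=> oU fg sf k; apply: Ck_eq (sf k). Qed.

Lemma smooth_sub (V W : normedModType R) (U U' : set V) (f : V -> W) :
  U' `<=` U -> smooth_on U f -> smooth_on U' f.
Proof. by move=> sUU' sf k; apply: Ck_sub (sf k). Qed.

Lemma smooth_derive (V W : normedModType R) (U : set V) (f : V -> W) v :
  smooth_on U f -> smooth_on U (fun x => 'D_v f x).
Proof. by move=> sf k; have [_ Df] := sf k.+1; exact: Df. Qed.

Lemma smooth_diff (V W : normedModType R) (U : set V) (f : V -> W) x :
  smooth_on U f -> U x -> differentiable f x.
Proof. by move=> sf Ux; have [df _] := sf 1%N; exact: df. Qed.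

End SmoothFacts.

Record chart (R : realType) (T : topologicalType) (n : nat) := Chart {
  cdom : set T;
  cimg : set 'rV[R]_n;
  cmap : T -> 'rV[R]_n;
  cinv : 'rV[R]_n -> T;
  cdom_open : open cdom;
  cimg_open : open cimg;
  cmap_img : forall p, cdom p -> cimg (cmap p);
  cinv_dom : forall x, cimg x -> cdom (cinv x);
  cmapK : forall p, cdom p -> cinv (cmap p) = p;
  cinvK : forall x, cimg x -> cmap (cinv x) = x;
  cmap_continuous : forall p, cdom p -> {for p, continuous cmap};
  cinv_continuous : forall x, cimg x -> {for x, continuous cinv} }.

(* Smooth manifolds without boundary, Hausdorff and second countable. The
   smooth structure is given by an indexed atlas, not required to be maximal;
   [chart_at p] is a preferred chart around [p], used below to represent the
   tangent space at [p]. *)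
Record manifold (R : realType) := Manifold {
  carrier :> topologicalType;
  mdim : nat;
  midx : Type;
  mchart : midx -> chart R carrier mdim;
  chart_at : carrier -> midx;
  chart_atP : forall p, cdom (mchart (chart_at p)) p;
  mhausdorff : hausdorff_space carrier;
  msecond_countable : @second_countable carrier;
  mcompat : forall a b : midx,
    smooth_on
      [set x | cimg (mchart a) x /\ cdom (mchart b) (cinv (mchart a) x)]
      (cmap (mchart b) \o cinv (mchart a)) }.

Definition smooth_fun (R : realType) (M : manifold R) (V : normedModType R)
    (W : set M) (f : M -> V) : Prop :=
  forall a : midx M,
    smooth_on [set x | cimg (mchart a) x /\ W (cinv (mchart a) x)]
              (f \o cinv (mchart a)).

Definition smooth_map (R : realType) (M N : manifold R) (U : set M)
    (f : M -> N) : Prop :=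
  (forall p, U p -> {for p, continuous f}) /\
  forall (a : midx M) (b : midx N),
    smooth_on [set x | [/\ cimg (mchart a) x, U (cinv (mchart a) x) &
                           cdom (mchart b) (f (cinv (mchart a) x))]]
              (cmap (mchart b) \o f \o cinv (mchart a)).

(* Smooth real vector bundles of finite rank, given by a family of fibres and
   an atlas of local trivialisations with smooth transition functions (which
   determines the topology and the smooth structure of the total space). The
   values of [vb_map i p] and [vb_inv i p] are irrelevant for [p] outside
   [vb_dom i]. *)
Record vbundle (R : realType) (M : manifold R) := VBundle {
  vb_fibre :> M -> lmodType R;
  vb_rank : nat;
  vb_idx : Type;
  vb_dom : vb_idx -> set M;
  vb_map : forall (i : vb_idx) (p : M), {linear vb_fibre p -> 'rV[R]_vb_rank};
  vb_inv : forall (i : vb_idx) (p : M), {linear 'rV[R]_vb_rank -> vb_fibre p};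
  vb_dom_open : forall i, open (vb_dom i);
  vb_cover : forall p, exists i, vb_dom i p;
  vb_mapK : forall i p, vb_dom i p -> cancel (vb_map i p) (vb_inv i p);
  vb_invK : forall i p, vb_dom i p -> cancel (vb_inv i p) (vb_map i p);
  vb_compat : forall i j (w : 'rV[R]_vb_rank),
    smooth_fun (vb_dom i `&` vb_dom j) (fun p => vb_map j p (vb_inv i p w)) }.

Section TangentBundle.
Context {R : realType} (M : manifold R).
Implicit Types (a b c : midx M) (p : M).

Local Notation E := 'rV[R]_(mdim M).

Definition transition a b : E -> E := cmap (mchart b) \o cinv (mchart a).

(* The tangent space at [p] is [E], seen through the preferred chart at [p]:
   [tcoord a p v] are the coordinates in the chart [a] of the tangent vector
   whose coordinates in the chart [chart_at p] are [v], and [tvect a p] is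
   the inverse map. *)
Definition tcoord a p : {linear E -> E} :=
  'd (transition (chart_at p) a) (cmap (mchart (chart_at p)) p).

Definition tvect a p : {linear E -> E} :=
  'd (transition a (chart_at p)) (cmap (mchart a) p).

Let odom a (W : set M) : open W ->
  open [set x | cimg (mchart a) x /\ W (cinv (mchart a) x)].
Proof.
move=> oW; rewrite openE => x [xi Wx] /=; rewrite /interior.
have n1 : nbhs x (cimg (mchart a)).
  by apply: open_nbhs_nbhs; split; [exact: cimg_open|].
have n2 : nbhs x (cinv (mchart a) @^-1` W).
  by apply: (cinv_continuous xi); apply: open_nbhs_nbhs.
exact: filterI n1 n2.
Qed.

Lemma transition_differentiable a b p :
  cdom (mchart a) p -> cdom (mchart b) p ->
  differentiable (transition a b) (cmap (mchart a) p).
Proof.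
move=> ap bp; apply: smooth_diff (mcompat a b) _; split=> /=.
  exact: cmap_img.
by rewrite cmapK.
Qed.

Lemma transition_chain a b c p (v : E) :
  cdom (mchart a) p -> cdom (mchart b) p -> cdom (mchart c) p ->
  'd (transition b c) (cmap (mchart b) p)
     ('d (transition a b) (cmap (mchart a) p) v) =
  'd (transition a c) (cmap (mchart a) p) v.
Proof.
move=> ap bp cp.
have dab := transition_differentiable ap bp.
have abp : transition a b (cmap (mchart a) p) = cmap (mchart b) p.
  by rewrite /transition /= cmapK.
have dbc := transition_differentiable bp cp; rewrite -abp in dbc *.
have dabc := differentiable_comp dab dbc.
apply: (etrans (esym (congr1 (fun h : E -> E => h v) (diff_comp dab dbc)))).
apply: (etrans (esym (deriveE v dabc))).
apply: (etrans _ (deriveE v (transition_differentiable ap cp))).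
apply: near_eq_derive.
have pD : [set x | cimg (mchart a) x /\ cdom (mchart b) (cinv (mchart a) x)]
  (cmap (mchart a) p) by split=> /=; [exact: cmap_img|rewrite cmapK].
have oD := @odom a _ (cdom_open (mchart b)).
apply: filterS (open_nbhs_nbhs (conj oD pD)) => x [xi xb].
by rewrite /transition /= cmapK.
Qed.

Lemma transition_id a p (v : E) : cdom (mchart a) p ->
  'd (transition a a) (cmap (mchart a) p) v = v.
Proof.
move=> ap; rewrite -deriveE; last exact: transition_differentiable.
rewrite -[RHS](derive_id (cmap (mchart a) p) v); apply: near_eq_derive.
have oi : open_nbhs (cmap (mchart a) p) (cimg (mchart a)).
  by split; [exact: cimg_open|exact: cmap_img].
by apply: filterS (open_nbhs_nbhs oi) => x xi; rewrite /transition /= cinvK.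
Qed.

Let tcoordK a p : cdom (mchart a) p -> cancel (tcoord a p) (tvect a p).
Proof.
move=> ap v; rewrite /tvect /tcoord transition_chain ?transition_id //;
  exact: chart_atP.
Qed.

Let tvectK a p : cdom (mchart a) p -> cancel (tvect a p) (tcoord a p).
Proof.
move=> ap v; rewrite /tvect /tcoord transition_chain ?transition_id //;
  exact: chart_atP.
Qed.

Let tcover p : exists a, cdom (mchart a) p.
Proof. by exists (chart_at p); exact: chart_atP. Qed.

Let tcompat a b (w : E) :
  smooth_fun (cdom (mchart a) `&` cdom (mchart b))
             (fun p => tcoord b p (tvect a p w)).
Proof.
move=> c; set D := [set x | _].
have oD : open D by apply: odom; apply: openI; exact: cdom_open.
pose D' := [set x | cimg (mchart a) x /\ cdom (mchart b) (cinv (mchart a) x)].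
have oD' : open D' by apply: odom; exact: cdom_open.
have DD' x : D x -> D' (transition c a x).
  by move=> [xi [/= xa xb]]; split; [exact: cmap_img|rewrite /transition /= cmapK].
have sc : smooth_on D (transition c a).
  by apply: smooth_sub (mcompat c a) => x [xi [xa _]].
have H := smooth_comp oD DD' oD' sc (smooth_derive w (mcompat a b)).
apply: smooth_eq H => // x [xi [/= xa xb]].
rewrite /tcoord /tvect transition_chain //; last exact: chart_atP.
by rewrite -deriveE //; exact: transition_differentiable.
Qed.

Definition tangent_bundle : vbundle M :=
  @VBundle R M (fun=> E) (mdim M) (midx M) (fun a => cdom (mchart a))
    tcoord tvect (fun a => cdom_open (mchart a)) tcover tcoordK tvectK tcompat.

End TangentBundle.

Arguments tangent_bundle {R} M.

Definition dmap (R : realType) (M N : manifold R) (f : M -> N) (p : M) :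
    {linear tangent_bundle M p -> tangent_bundle N (f p)} :=
  'd (cmap (mchart (chart_at (f p))) \o f \o cinv (mchart (chart_at p)))
     (cmap (mchart (chart_at p)) p).

(* Smoothness over [U] of a family of linear maps [E_(f p) -> F_(g p)], that is
   of a vector bundle morphism [f^*E -> g^*F] over the identity of [U]. *)
Definition smooth_morphism (R : realType) (S M N : manifold R)
    (E : vbundle M) (F : vbundle N) (f : S -> M) (g : S -> N) (U : set S)
    (L : forall p : S, {linear E (f p) -> F (g p)}) : Prop :=
  forall (i : vb_idx E) (j : vb_idx F) (w : 'rV[R]_(vb_rank E)),
    smooth_fun [set p | [/\ U p, vb_dom i (f p) & vb_dom j (g p)]]
               (fun p => vb_map j (g p) (L p (vb_inv i (f p) w))).

(* [L] restricts to a vector bundle isomorphism [E|_U -> g^*F] over the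
   identity of the open set [U]. *)
Definition vb_isomorphism (R : realType) (S N : manifold R)
    (E : vbundle S) (F : vbundle N) (g : S -> N) (U : set S)
    (L : forall p : S, {linear E p -> F (g p)}) : Prop :=
  smooth_morphism (f := idfun) (g := g) U L /\
  exists L' : forall p : S, {linear F (g p) -> E p},
    smooth_morphism (f := g) (g := idfun) U L' /\
    forall p, U p -> cancel (L p) (L' p) /\ cancel (L' p) (L p).

Record fibre_metric (R : realType) (M : manifold R) (E : vbundle M) :=
  FibreMetric {
    fm :> forall p : M, E p -> E p -> R;
    fm_sym : forall p (u v : E p), fm u v = fm v u;
    fm_linear : forall p (a : R) (u v w : E p),
      fm (a *: u + v) w = a * fm u w + fm v w;
    fm_pos : forall p (v : E p), v != 0 -> 0 < fm v v;
    fm_smooth : forall (i : vb_idx E) (w w' : 'rV[R]_(vb_rank E)),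
      smooth_fun (V := R^o) (vb_dom i)
        (fun p => fm (vb_inv i p w) (vb_inv i p w')) }.

Arguments fm {R M E} f p u v.

Definition riemannian_metric (R : realType) (M : manifold R) :=
  fibre_metric (tangent_bundle M).

Section Distance.
Context {R : realType} (M : manifold R) (g : riemannian_metric M).

(* Smooth arcs are parametrised by [0, 1]; smoothness on the closed interval
   means smoothness on some open interval containing it. *)
Definition smooth_arc (c : R -> M) : Prop :=
  exists2 e : R, 0 < e &
    (forall t : R, - e < t < 1 + e -> {for t, continuous c}) /\
    forall a : midx M,
      @smooth_on R R^o _ [set t : R | - e < t < 1 + e /\ cdom (mchart a) (c t)]
                 (cmap (mchart a) \o c).

Definition velocity (c : R -> M) (t : R) : tangent_bundle M (c t) :=
  derive1 (cmap (mchart (chart_at (c t))) \o c) t.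

Definition arc_length (c : R -> M) : \bar R :=
  \int[lebesgue_measure]_(t in `[0, 1])
    (Num.sqrt (g (c t) (velocity c t) (velocity c t)))%:E.

(* Piecewise smooth curves from [p] to [q], as chains of smooth arcs. *)
Fixpoint piecewise_smooth (p : M) (s : seq (R -> M)) (q : M) : Prop :=
  match s with
  | [::] => p = q
  | c :: s' => [/\ smooth_arc c, c 0 = p & piecewise_smooth (c 1) s' q]
  end.

Definition curve_length (s : seq (R -> M)) : \bar R :=
  (\sum_(c <- s) arc_length c)%E.

(* The value is [+oo] when [p] and [q] lie in distinct components. *)
Definition riemannian_distance (p q : M) : \bar R :=
  ereal_inf [set curve_length s | s in [set s | piecewise_smooth p s q]].

End Distance.

Section Einstein.
Context {R : realType} (M : manifold R).

Local Notation E := 'rV[R]_(mdim M).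

Definition metric_coef (g : riemannian_metric M) (b : midx M) (x : E) :
    'M[R]_(mdim M) :=
  \matrix_(i, j) g (cinv (mchart b) x)
    (tvect b (cinv (mchart b) x) (delta_mx 0 i))
    (tvect b (cinv (mchart b) x) (delta_mx 0 j)).

Definition partial (i : 'I_(mdim M)) (f : E -> R^o) (x : E) : R :=
  'D_(delta_mx 0 i) f x.

(* [christoffel G k i j] is Gamma^k_(ij). *)
Definition christoffel (G : E -> 'M[R]_(mdim M)) (k i j : 'I_(mdim M))
    (x : E) : R :=
  2^-1 * \sum_l invmx (G x) k l *
    (partial i (fun y => G y j l) x + partial j (fun y => G y i l) x
     - partial l (fun y => G y i j) x).

Definition ricci (G : E -> 'M[R]_(mdim M)) (x : E) : 'M[R]_(mdim M) :=
  \matrix_(i, j) \sum_k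
    (partial k (christoffel G k i j) x - partial j (christoffel G k i k) x
     + \sum_l (christoffel G k k l x * christoffel G l i j x
               - christoffel G k j l x * christoffel G l i k x)).

Definition einstein (g : riemannian_metric M) : Prop :=
  exists lambda : R, forall (b : midx M) (x : E), cimg (mchart b) x ->
    ricci (metric_coef g b) x = lambda *: metric_coef g b x.

(* Joint smoothness in the parameter and in the point of the manifold. *)
Definition smooth_family (S : manifold R) (g : S -> riemannian_metric M) :
    Prop :=
  forall (a : midx S) (b : midx M) (i j : 'I_(mdim M)),
    @smooth_on R ('rV[R]_(mdim S) * E)%type R^o
      [set z | cimg (mchart a) z.1 /\ cimg (mchart b) z.2]
      (fun z => metric_coef (g (cinv (mchart a) z.1)) b z.2 i j).

End Einstein.

(* g_R = R^* h^Z *)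
Definition response_metric (R : realType) (S : manifold R) (Z : vbundle S)
    (hZ : fibre_metric Z) (Rm : forall p : S, {linear tangent_bundle S p -> Z p})
    (p : S) (X Y : tangent_bundle S p) : R :=
  hZ p (Rm p X) (Rm p Y).

(* Main.v *)
(* In the preferred charts at p and Theta p, the map Theta has injective
   differential at p: Psi is injective and d Theta = Psi o R, while g_R is
   positive definite at p. A C^1 map with injective differential at a point
   satisfies c |x - y| <= |f x - f y| near this point. On the source,
   d_S(p1, p2) is at most the length of the straight segment in the chart, hence
   at most C |x - y|.

   On the target, a curve may leave the chart. Instead of following it up to its
   first exit time, we use the functions
     G q = max (0, r^2 - |y - o|^2)^2 * (y_i - a),   y the coordinates of q,
   extended by 0 outside the chart. They are C^1 on the whole of N (the manifold
   is Hausdorff, so the image of the compact ball is closed) and satisfy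
   |dG w| <= K |w|_gN, so that |G q2 - G q1| <= K * length for every curve from
   q1 to q2. Taking for a the i-th coordinate of q1 bounds each coordinate of
   y2 - y1 by a constant times d_N. *)
Require Import Defs.
From mathcomp Require Import all_boot all_order all_algebra.
From mathcomp Require Import all_classical all_reals all_analysis
  measurable_realfun.
From mathcomp Require Import ring lra.

Set Implicit Arguments.
Unset Strict Implicit.
Unset Printing Implicit Defensive.

Import Order.TTheory GRing.Theory Num.Theory.
Import numFieldNormedType.Exports.

Local Open Scope classical_set_scope.
Local Open Scope ring_scope.

(** * Integral estimates relating the variation of a function along a curve to the speed *)

(* The integral of a nonnegative function is a supremum over simple functions
   below it, so no measurability is needed. *)
Lemma ge0_le_integral_nonmeasurable d (T : measurableType d) (R : realType)
    (mu : {measure set T -> \bar R}) (D : set T) (f1 f2 : T -> \bar R) :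
  (forall x, D x -> 0 <= f1 x)%E -> (forall x, D x -> f1 x <= f2 x)%E ->
  (\int[mu]_(x in D) f1 x <= \int[mu]_(x in D) f2 x)%E.
Proof.
move=> f1_ge0 f12.
have f2_ge0 x : D x -> (0 <= f2 x)%E.
  by move=> Dx; apply: le_trans (f12 x Dx); exact: f1_ge0.
rewrite !ge0_integralE //; apply: ereal_sup_le => _ [h hf <-].
by exists h => // x; apply: le_trans (hf x) _; exact: lee_restrict.
Qed.

(** The fundamental theorem of calculus writes [H 1 - H 0] as the integral of [derive1 H], which is
    continuous and hence measurable. Its absolute value is then compared pointwise with [K * l],
    where [l] will be the speed of a curve. *)
Lemma integral_speed_bound (R : realType) (H l : R -> R) (e K : R) :
  0 < e -> 0 < K ->
  (forall t : R, - e < t < 1 + e -> derivable H t 1) ->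
  (forall t : R, - e < t < 1 + e -> {for t, continuous (derive1 H)}) ->
  (forall t : R, 0 <= t <= 1 -> `|derive1 H t| <= K * l t) ->
  (`|H 1 - H 0|%:E <=
    K%:E * \int[lebesgue_measure]_(t in `[0%R, 1%R]) (l t)%:E)%E.
Proof.
move=> e0 K0 dH cH Hl.
have inI t : 0 <= t <= 1 -> - e < t < 1 + e.
  by move=> /andP[? ?]; apply/andP; split; lra.
have cHI : {within `[0, 1], continuous (derive1 H)}.
  apply: continuous_in_subspaceT => t; rewrite inE /= in_itv /= => /inI.
  exact: cH.
pose dHt : R -> R := derive1 H.
have mH := @subspace_continuous_measurable_fun R _ dHt (measurable_itv _) cHI.
have {}mH := (measurable_EFinP _ _).2 mH.
have cnt t : 0 <= t <= 1 -> {for t, continuous H}.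
  move=> /inI /dH /derivable1_diffP; exact: differentiable_continuous.
have FTC := @continuous_FTC2 _ (derive1 H) H 0 1 ltr01 cHI.
rewrite -abse_EFin EFinB -FTC; first last.
- by [].
- split.
  + by move=> t; rewrite in_itv /= => /andP[? ?]; apply: dH; apply: inI;
    apply/andP; split; lra.
  + by apply: cvg_at_right_filter; apply: cnt; rewrite lexx ler01.
  + by apply: cvg_at_left_filter; apply: cnt; rewrite lexx ler01.
apply: le_trans (le_abse_integral _ _ _) _ => //.
rewrite -lee_pdivrMl // -ge0_integralZl //; first last.
- by rewrite lee_fin invr_ge0 ltW.
- exact: measurableT_comp mH.
apply: ge0_le_integral_nonmeasurable => t; rewrite /= in_itv /= => t01.
  by rewrite mule_ge0 // lee_fin invr_ge0 ltW.
by rewrite lee_fin ler_pdivrMl //; exact: Hl.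
Qed.

Lemma integral_speed_le (R : realType) (l : R -> R) (K : R) :
  (forall t : R, 0 <= t <= 1 -> 0 <= l t <= K) ->
  (\int[lebesgue_measure]_(t in `[0%R, 1%R]) (l t)%:E <= K%:E)%E.
Proof.
move=> lK; have <- : (\int[lebesgue_measure]_(t in `[0%R, 1%R]) K%:E = K%:E)%E.
  rewrite integral_cst //= lebesgue_measure_itv /= lte_fin ltr01.
  by rewrite -EFinD subr0 mule1.
by apply: ge0_le_integral_nonmeasurable => t;
  rewrite /= in_itv /= => /lK /andP[];
  rewrite !lee_fin.
Qed.

(** * A compactly supported C^1 cutoff of a coordinate function on R^n *)

(** Squaring the positive part removes its corner: the error of the first-order expansion at [s] is
    at most [h ^+ 2], by cases on the signs of [s] and [h + s]. *)
Lemma is_derive_sqr_max0 (R : realType) (s : R) :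
  is_derive s 1 (fun x : R => Num.max 0 x ^+ 2) (2 * Num.max 0 s).
Proof.
have key h : `|Num.max 0 (h + s) ^+ 2 - Num.max 0 s ^+ 2 - 2 * Num.max 0 s * h|
    <= h ^+ 2.
  rewrite ler_norml /Num.max; case: ltP => ?; case: ltP => ?; apply/andP;
    split; nra.
suff H : (fun h : R => h^-1 *: (Num.max 0 (h *: 1 + s) ^+ 2 - Num.max 0 s ^+ 2))
    @ 0^' --> 2 * Num.max 0 s.
  by apply: DeriveDef; [apply/cvg_ex; exists (2 * Num.max 0 s)|exact: cvg_lim].
apply/cvgrPdist_le => e e0; near=> h.
have h0 : h != 0 by near: h; exact: nbhs_dnbhs_neq.
have he : `|h| <= e.
  near: h; apply: nbhs_dnbhs; apply/nbhs_ballP; exists e => //= z.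
  by rewrite /ball /= sub0r normrN => /ltW.
rewrite distrC [h *: 1]mulr1 [_ *: _]mulrC.
rewrite -(ler_pM2r (_ : 0 < `|h|)) ?normr_gt0 //.
rewrite -normrM mulrBl mulrVK ?unitfE //.
apply: le_trans (key h) _; rewrite -real_normK ?num_real // expr2.
by rewrite ler_wpM2r.
Unshelve. all: by end_near. Qed.

Lemma continuous_sum_ord (R : realType) (T : topologicalType) n
    (F : 'I_n -> T -> R) (t : T) :
  (forall j, {for t, continuous (F j)}) ->
  {for t, continuous (fun s => \sum_j F j s)}.
Proof.
move=> cF; apply: (@cvg_big R _ (fun u v : R => u + v)) => [|j _];
  last exact: cF.
exact: add_continuous.
Qed.

Section Bump.
Context {R : realType} {n : nat}.
Implicit Types (y v : 'rV[R]_n) (r a : R) (i : 'I_n).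

Lemma ler_coord_norm v i : `|v 0 i| <= `|v|.
Proof.
rewrite [`|v|]mx_normrE.
exact: (le_bigmax _ (fun ij => `|v ij.1 ij.2|) (0, i)).
Qed.

Lemma ler_norm_coord v (K : R) : 0 <= K -> (forall i, `|v 0 i| <= K) ->
  `|v| <= K.
Proof.
move=> K0 vK; rewrite [`|v|]mx_normrE; apply/bigmax_leP; split=> //= -[j i] _.
by rewrite ord1; exact: vK.
Qed.

Lemma is_derive_coord (y : R -> 'rV[R]_n) (w : 'rV[R]_n) (t : R) i :
  is_derive t 1 y w -> is_derive t 1 (fun s => y s 0 i) (w 0 i).
Proof.
move=> [dy <-]; apply: DeriveDef; first exact: (derivable_mxP _ _ _).1 dy 0 i.
by rewrite (derive_mx dy) mxE.
Qed.

(** Nonnegative exactly on the closed Euclidean ball of radius [r] (for [r >= 0]). The Euclidean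
    square is polynomial, unlike the norm of row vectors, which is the maximum norm. *)
Definition sqgap (y0 : 'rV[R]_n) r y : R :=
  r ^+ 2 - \sum_j (y 0 j - y0 0 j) ^+ 2.

Definition bump_coord (y0 : 'rV[R]_n) r a i y : R :=
  Num.max 0 (sqgap y0 r y) ^+ 2 * (y 0 i - a).

(* The differential of [bump_coord y0 r a i] at [y], applied to [v]. *)
Definition dbump_coord (y0 : 'rV[R]_n) r a i y v : R :=
  2 * Num.max 0 (sqgap y0 r y) * (- \sum_j 2 * (y 0 j - y0 0 j) * v 0 j)
    * (y 0 i - a) + Num.max 0 (sqgap y0 r y) ^+ 2 * v 0 i.

Lemma sqgap_continuous (y0 : 'rV[R]_n) r : continuous (sqgap y0 r).
Proof.
move=> y.
have cB (j : 'I_n) (b : R) :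
    (fun u : 'rV[R]_n => u 0 j - b) @ y --> y 0 j - b.
  have ck : (fun u : 'rV[R]_n => u 0 j) @ y --> y 0 j.
    exact: coord_continuous.
  exact: (cvgB ck (cvg_cst b)).
have cs : {for y, continuous
    (fun u : 'rV[R]_n => \sum_j (u 0 j - y0 0 j) ^+ 2)}.
  by apply: continuous_sum_ord => j; exact: (cvgM (cB _ _) (cB _ _)).
exact: (cvgB (cvg_cst (r ^+ 2)) cs).
Qed.

Lemma is_derive_sqgap (y0 : 'rV[R]_n) r (y : R -> 'rV[R]_n) w (t : R) :
  is_derive t 1 y w ->
  is_derive t 1 (fun s => sqgap y0 r (y s))
    (- \sum_j 2 * (y t 0 j - y0 0 j) * w 0 j).
Proof.
move=> dy; rewrite /sqgap.
have dj j : is_derive t 1 (fun s => (y s 0 j - y0 0 j) ^+ 2)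
    (2 * (y t 0 j - y0 0 j) * w 0 j).
  have dyj := is_deriveB (is_derive_coord j dy) (is_derive_cst (y0 0 j) t 1).
  apply: (is_derive_eq (is_deriveM dyj dyj)).
  rewrite subr0 /GRing.scale /= /cst !fctE; ring.
have := is_deriveB (is_derive_cst (r ^+ 2) t 1) (is_derive_sum dj).
rewrite sub0r; congr is_derive; apply/funext => s.
by rewrite !fctE /= fct_sumE.
Qed.

Lemma is_derive_bump_coord (y0 : 'rV[R]_n) r a i (y : R -> 'rV[R]_n) w (t : R) :
  is_derive t 1 y w ->
  is_derive t 1 (fun s => bump_coord y0 r a i (y s))
    (dbump_coord y0 r a i (y t) w).
Proof.
move=> dy; rewrite /bump_coord.
have d1 := @is_derive1_comp _ _ (fun s => sqgap y0 r (y s)) _ _ _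
  (is_derive_sqr_max0 (sqgap y0 r (y t))) (is_derive_sqgap y0 r dy).
have d2 := is_deriveB (is_derive_coord i dy) (is_derive_cst a t 1).
apply: (is_derive_eq (is_deriveM d1 d2)).
rewrite subr0 /dbump_coord /GRing.scale /= !fctE /=; ring.
Qed.

Lemma dbump_coord_out (y0 : 'rV[R]_n) r a i y v : sqgap y0 r y <= 0 ->
  dbump_coord y0 r a i y v = 0.
Proof.
by move=> h; rewrite /dbump_coord max_l // expr0n /= mulr0 !mul0r addr0.
Qed.

Lemma sqgap_gt0_coord (y0 : 'rV[R]_n) r y j : 0 < r -> 0 <= sqgap y0 r y ->
  `|y 0 j - y0 0 j| <= r.
Proof.
move=> r0; rewrite /sqgap (bigD1 j) //= => h.
rewrite -(ler_pXn2r (ltn0Sn 1)) ?nnegrE ?normr_ge0 ?(ltW r0) //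
  real_normK ?num_real //.
have : 0 <= \sum_(k | k != j) (y 0 k - y0 0 k) ^+ 2.
  by apply: sumr_ge0 => k _; exact: sqr_ge0.
by lra.
Qed.

(** The differential vanishes off the ball. In the ball the gap is at most [r ^+ 2], each
    [y 0 j - y0 0 j] is at most [r] and [y 0 i - a] at most [2 * r] in absolute value. The first
    term then contributes [8 * n * r ^+ 4] and the second [r ^+ 4]. *)
Lemma dbump_coord_le (y0 : 'rV[R]_n) r a i y v : 0 < r -> `|y0 0 i - a| <= r ->
  `|dbump_coord y0 r a i y v| <= (8 * n%:R + 1) * r ^+ 4 * `|v|.
Proof.
move=> r0 har; have [h|h] := leP (sqgap y0 r y) 0.
  rewrite dbump_coord_out // normr0 !mulr_ge0 ?exprn_ge0 ?(ltW r0) //.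
have hy j := sqgap_gt0_coord j r0 (ltW h).
have hg : sqgap y0 r y <= r ^+ 2.
  by rewrite /sqgap lerBlDr lerDl; apply: sumr_ge0 => k _; exact: sqr_ge0.
rewrite /dbump_coord max_r ?(ltW h) //.
have hs : `|\sum_j 2 * (y 0 j - y0 0 j) * v 0 j| <= n%:R * (2 * r * `|v|).
  apply: le_trans (ler_norm_sum _ _ _) _.
  have -> : n%:R * (2 * r * `|v|) = \sum_(j < n) (2 * r * `|v|).
    by rewrite sumr_const card_ord mulr_natl.
  apply: ler_sum => j _.
  rewrite !normrM ger0_norm // ler_pM // ?mulr_ge0 //;
    last exact: ler_coord_norm.
  by rewrite ler_pM2l.
have ha : `|y 0 i - a| <= 2 * r.
  rewrite (_ : _ - a = (y 0 i - y0 0 i) + (y0 0 i - a)); last by ring.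
  apply: le_trans (ler_normD _ _) _; have := hy i; lra.
apply: le_trans (ler_normD _ _) _.
rewrite 3![in X in X + _]normrM normrN [in X in _ + X]normrM.
rewrite (ger0_norm (ltW h)) (ger0_norm (sqr_ge0 _)) normr_nat.
have alg (q S A u N : R) : 0 <= q -> q <= r ^+ 2 -> 0 <= S ->
    S <= n%:R * (2 * r * N) -> 0 <= A -> A <= 2 * r -> 0 <= u -> u <= N ->
    2 * q * S * A + q ^+ 2 * u <= (8 * n%:R + 1) * r ^+ 4 * N.
  move=> q0 hq S0 hS A0 hA u0 hu.
  have -> : (8 * n%:R + 1) * r ^+ 4 * N =
    2 * r ^+ 2 * (n%:R * (2 * r * N)) * (2 * r) + (r ^+ 2) ^+ 2 * N by ring.
  have h1 : 2 * q * S <= 2 * r ^+ 2 * (n%:R * (2 * r * N)).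
    by rewrite ler_pM ?mulr_ge0 ?ler_pM2l.
  have h2 : q ^+ 2 <= (r ^+ 2) ^+ 2 by rewrite !expr2 ler_pM -?expr2.
  apply: lerD; last exact: ler_pM (sqr_ge0 _) _ _ _.
  by apply: ler_pM h1 hA => //; rewrite !mulr_ge0.
apply: alg => //; first exact: ltW.
exact: ler_coord_norm.
Qed.

Lemma dbump_coord_continuous (y0 : 'rV[R]_n) r a i (y w : R -> 'rV[R]_n) t :
  {for t, continuous y} -> {for t, continuous w} ->
  {for t, continuous (fun s => dbump_coord y0 r a i (y s) (w s))}.
Proof.
move=> cy cw.
have cyj j : (fun s => y s 0 j) @ t --> y t 0 j.
  apply: (@continuous_comp _ _ _ y (fun M : 'rV[R]_n => M 0 j)) => //.
  exact: coord_continuous.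
have cwj j : (fun s => w s 0 j) @ t --> w t 0 j.
  apply: (@continuous_comp _ _ _ w (fun M : 'rV[R]_n => M 0 j)) => //.
  exact: coord_continuous.
have cB j (b : R) : (fun s => y s 0 j - b) @ t --> y t 0 j - b.
  by apply: cvgB; [exact: cyj|exact: cvg_cst].
have cmax : (fun s => Num.max 0 (sqgap y0 r (y s))) @ t -->
    Num.max 0 (sqgap y0 r (y t)).
  apply: (@continuous_comp _ _ _ (fun s => sqgap y0 r (y s))
    (fun x : R => Num.max 0 x)).
    by apply: (@continuous_comp _ _ _ y (sqgap y0 r)) => //;
      exact: sqgap_continuous.
  by apply: continuous_max; [exact: cst_continuous|exact: id].
apply: cvgD; last first.
  by apply: cvgM (cwj i); exact: (cvgM cmax cmax).
apply: cvgM; last exact: cB.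
apply: cvgM; first by apply: cvgM => //; exact: cvg_cst.
apply: cvgN; apply: continuous_sum_ord => j; apply: cvgM (cwj j).
by apply: cvgM (cB _ _); exact: cvg_cst.
Qed.

End Bump.

(** * Lower Lipschitz bound for a C^1 map with injective differential at a point *)

Lemma is_derive_diff_comp (R : realType) (V W : normedModType R) (f : V -> W)
    (y : R -> V) (t : R) (w : V) :
  is_derive t 1 y w -> differentiable f (y t) ->
  is_derive t 1 (fun s => f (y s)) ('d f (y t) w).
Proof.
move=> [dy <-] df; have dy' := (derivable1_diffP _ _).1 dy.
have dfy := differentiable_comp dy' df.
apply: DeriveDef; first exact: diff_derivable dfy.
by rewrite (deriveE _ dfy) (deriveE _ dy') (diff_comp dy' df).
Qed.

Lemma is_derive_line (R : realType) (V : normedModType R) (u v : V) (t : R) :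
  is_derive t 1 (fun s : R => s *: v + u) v.
Proof.
suff H :
    (fun h : R => h^-1 *: (((h *: 1 + t) *: v + u) - (t *: v + u))) @ 0^' --> v.
  by apply: DeriveDef; [apply/cvg_ex; exists v|exact: cvg_lim].
apply: cvg_near_cst; near=> h.
have h0 : h != 0 by near: h; exact: nbhs_dnbhs_neq.
by rewrite opprD addrACA subrr addr0 -scalerBl addrK scalerA [h *: 1]mulr1
  mulVf // scale1r.
Unshelve. all: by end_near. Qed.

(** The unit sphere is compact, so [phi] attains a minimum on it, and this minimum is positive. *)
Lemma sphere_lower_bound (R : realType) n (phi : 'rV[R]_n -> R) :
  continuous phi -> (forall v, v != 0 -> 0 < phi v) ->
  exists2 c : R, 0 < c & forall v, `|v| = 1 -> c <= phi v.
Proof.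
move=> cphi phi_gt0; pose A := [set v : 'rV[R]_n | `|v| = 1].
(* The sphere is empty when [n = 0]; any positive constant then works. *)
have [/eqP A0|/set0P A0] := boolP (A == set0).
  by exists 1 => // v v1; exfalso; have : A v by []; rewrite A0.
have cA : compact A.
  apply: bounded_closed_compact.
    by exists 1; split=> // M M1 v /= ->; exact: ltW.
  by apply: (@closed_comp _ _ (fun v : 'rV[R]_n => `|v|) [set 1]);
    [move=> v _; exact: norm_continuous|exact: closed_eq].
have [c /set_mem cA1 cmin] := EVT_min_rV A0 cA (continuous_subspaceT cphi).
exists (phi c); last by move=> v v1; apply: cmin; rewrite inE.
by apply: phi_gt0; rewrite -normr_gt0 cA1.
Qed.

Lemma diff_row_sum (R : realType) m (W : normedModType R)
    (f : 'rV[R]_m -> W) (x v : 'rV[R]_m) : differentiable f x ->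
  'd f x v = \sum_i v 0 i *: 'D_(delta_mx 0 i) f x.
Proof.
move=> df; rewrite [in LHS](row_sum_delta v) linear_sum.
by apply: eq_bigr => i _; rewrite linearZ deriveE.
Qed.

Section LowerLipschitz.
Context {R : realType} {m n : nat}.
Variables (D : set 'rV[R]_m) (f : 'rV[R]_m -> 'rV[R]_n) (o : 'rV[R]_m).
Hypotheses (D_open : open D) (f_C1 : Ck_on 1 D f) (Do : D o).

(** On a small ball all partial derivatives are close to those at [o]. The mean value theorem,
    applied to each coordinate of [f] minus its linear part along the segment from [y] to [x], turns
    this into the estimate. *)
Lemma strict_differentiability (e : R) : 0 < e ->
  exists2 r : R, 0 < r & forall x y, `|o - x| < r -> `|o - y| < r ->
    [/\ D x, D y & `|f x - f y - 'd f o (x - y)| <= e * `|x - y|].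
Proof.
move=> e0; have [df Df] := f_C1.
(* The error adds up over [m] partial derivatives; the successor keeps the divisor nonzero when
   [m = 0]. *)
pose ep := e / m.+1%:R; have ep0 : 0 < ep by rewrite divr_gt0.
have nD : \forall x \near o, D x by exact: open_nbhs_nbhs.
have nDf : \forall x \near o,
    forall i, `|'D_(delta_mx 0 i) f o - 'D_(delta_mx 0 i) f x| <= ep.
  apply: (@filter_forall _ _ _ _ (nbhs_filter o)) => i.
  have cDi : {for o, continuous (fun x => 'D_(delta_mx 0 i) f x)} := Df _ o Do.
  by move/cvgrPdist_le : cDi => /(_ ep ep0).
have [r /= r0 Hr] := (nbhs_normP _ _).1 (filterI nD nDf);
  exists r => // x y xr yr.
have [Dx _] := Hr x xr; have [Dy _] := Hr y yr; split=> //.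
pose v := x - y; pose z (t : R) := t *: v + y.
have zin (t : R) : 0 <= t <= 1 -> `|o - z t| < r.
  move=> /andP[t0 t1].
  rewrite (_ : o - z t = t *: (o - x) + (1 - t) *: (o - y)).
    apply: le_lt_trans (ler_normD _ _) _;
      rewrite !normrZ !ger0_norm ?subr_ge0 //.
    (* One of the weights [t] and [1 - t] is at least 1/2, which makes the convexity inequality
       strict. *)
    by have [h|h] := leP t (1 / 2); nra.
  by rewrite /z /v; apply/rowP => k; rewrite !mxE; ring.
have dz (t : R) : is_derive t 1 z v.
  exact: is_derive_line.
apply: ler_norm_coord => [|k]; first by rewrite mulr_ge0 // ltW.
pose h (t : R) : R := f (z t) 0 k - t * 'd f o v 0 k.
have dh (t : R) : 0 <= t <= 1 ->
    is_derive t 1 h ('d f (z t) v 0 k - 'd f o v 0 k).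
  move=> /zin /Hr[Dz _].
  have d1 := is_derive_coord k (is_derive_diff_comp (dz t) (df _ Dz)).
  have d2 := is_deriveM (is_derive_id t 1) (is_derive_cst ('d f o v 0 k) t 1).
  apply: (is_derive_eq (is_deriveB d1 d2)).
  by rewrite scaler0 add0r /GRing.scale /= mulr1.
have hd (t : R) : t \in `]0, 1[ ->
    is_derive t 1 h ('d f (z t) v 0 k - 'd f o v 0 k).
  by rewrite in_itv /= => /andP[t0 t1]; apply: dh; rewrite !ltW.
have hc : {within `[0, 1], continuous h}.
  apply: derivable_within_continuous => t; rewrite in_itv /= => t01.
  by have [] := dh t t01.
have [xi xi01 hE] := MVT ltr01 hd hc.
have {}xi01 : 0 <= xi <= 1.
  by move: xi01; rewrite in_itv /= => /andP[? ?]; rewrite !ltW.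
have -> : (f x - f y - 'd f o v) 0 k = h 1 - h 0.
  by rewrite /h /z !mxE scale1r scale0r add0r /v subrK; ring.
rewrite hE subr0 mulr1.
have [Dz Hz] := Hr _ (zin _ xi01).
have dE w : D w -> 'd f w v 0 k = \sum_i v 0 i * 'D_(delta_mx 0 i) f w 0 k.
  move=> Dw; apply: etrans
    (congr1 (fun u : 'rV[R]_n => u 0 k) (diff_row_sum v (df w Dw))) _.
  by rewrite summxE; apply: eq_bigr => i _; rewrite mxE.
have -> : 'd f (z xi) v 0 k - 'd f o v 0 k =
    \sum_i v 0 i * ('D_(delta_mx 0 i) f (z xi) - 'D_(delta_mx 0 i) f o) 0 k.
  apply: etrans (congr2 (fun p q : R => p - q) (dE _ Dz) (dE _ Do)) _.
  rewrite -sumrB; apply: eq_bigr => i _.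
  by rewrite -mulrBr !mxE.
apply: le_trans (ler_norm_sum _ _ _) _.
apply: (@le_trans _ _ (\sum_(i < m) (`|v| * ep))).
  apply: ler_sum => i _; rewrite normrM ler_pM //; first exact: ler_coord_norm.
  by apply: le_trans (ler_coord_norm _ _) _; rewrite distrC.
have epm : ep * m%:R <= e.
  by rewrite /ep -mulrA ler_piMr ?(ltW e0) // mulrC ler_pdivrMr //
    mul1r ler_nat.
rewrite sumr_const card_ord -mulr_natl.
have -> : m%:R * (`|v| * ep) = ep * m%:R * `|v|.
  by rewrite mulrCA mulrC [m%:R * _]mulrC.
exact: ler_wpM2r.
Qed.

(** By compactness of the sphere, an injective linear map satisfies [c * |v| <= |'d f o v|]. Near
    [o] the increment of [f] differs from its linear part by at most half of this. *)
Lemma immersion_lower_lipschitz : (forall v, v != 0 -> 'd f o v != 0) ->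
  exists c r : R, [/\ 0 < c, 0 < r & forall x y, `|o - x| < r -> `|o - y| < r ->
    [/\ D x, D y & c * `|x - y| <= `|f x - f y|]].
Proof.
move=> inj.
have [df _] := f_C1.
have cA : continuous (fun v => `|'d f o v|).
  move=> v; apply: (@continuous_comp _ _ _ ('d f o) (fun w => `|w|)).
    by apply: diff_continuous; exact: df.
  exact: norm_continuous.
have A_gt0 v : v != 0 -> 0 < `|'d f o v| by move=> v0; rewrite normr_gt0 inj.
have [c c0 cP] := sphere_lower_bound cA A_gt0.
have {}cP v : c * `|v| <= `|'d f o v|.
  have [->|v0] := eqVneq v 0; first by rewrite normr0 mulr0.
  have nv : 0 < `|v| by rewrite normr_gt0.
  have := cP (`|v|^-1 *: v);
    rewrite normrZ normfV normr_id mulVf ?gt_eqF // => /(_ erefl).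
  by rewrite linearZ normrZ normfV normr_id mulrC ler_pdivlMr.
have c2 : 0 < c / 2 by rewrite divr_gt0.
have [r r0 rP] := strict_differentiability c2.
exists (c / 2), r; split=> // x y xr yr; have [Dx Dy H] := rP x y xr yr;
  split=> //.
have := cP (x - y); have := lerB_dist ('d f o (x - y)) (f x - f y).
rewrite distrC in H; lra.
Qed.

End LowerLipschitz.

(** * Uniform bounds for a continuous family of quadratic forms *)

Section QuadraticForm.
Context {R : realType} {n : nat}.
Implicit Types (G : 'I_n -> 'I_n -> R) (v : 'rV[R]_n).

Definition quadratic_form G v : R := \sum_i \sum_j v 0 i * v 0 j * G i j.

Lemma quadratic_formZ G s v :
  quadratic_form G (s *: v) = s ^+ 2 * quadratic_form G v.
Proof.
rewrite mulr_sumr; apply: eq_bigr => i _; rewrite mulr_sumr.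
by apply: eq_bigr => j _; rewrite !mxE; ring.
Qed.

Lemma quadratic_formB G G' v :
  quadratic_form (fun i j => G i j - G' i j) v =
  quadratic_form G v - quadratic_form G' v.
Proof.
rewrite -sumrB; apply: eq_bigr => i _; rewrite -sumrB.
by apply: eq_bigr => j _; rewrite mulrBr.
Qed.

Lemma quadratic_form_le G v :
  `|quadratic_form G v| <= (\sum_i \sum_j `|G i j|) * `|v| ^+ 2.
Proof.
rewrite mulr_suml; apply: le_trans (ler_norm_sum _ _ _) _;
  apply: ler_sum => i _.
rewrite mulr_suml; apply: le_trans (ler_norm_sum _ _ _) _;
  apply: ler_sum => j _.
rewrite mulrC normrM ler_wpM2l // normrM expr2.
by rewrite ler_pM //; exact: ler_coord_norm.
Qed.

Lemma quadratic_form_continuous G : continuous (quadratic_form G).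
Proof.
move=> v; apply: continuous_sum_ord => i; apply: continuous_sum_ord => j.
have ck (k : 'I_n) : (fun u : 'rV[R]_n => u 0 k) @ v --> v 0 k.
  exact: coord_continuous.
exact: (cvgM (cvgM (ck i) (ck j)) (cvg_cst (G i j))).
Qed.

(** The form at [o] is bounded below on the sphere and, by homogeneity, everywhere. A small change
    of the coefficients changes the form by a small multiple of [|v| ^+ 2], uniformly in [v]. *)
Lemma quadratic_form_bounds (T : topologicalType) (G : T -> 'I_n -> 'I_n -> R)
    (o : T) :
  (forall i j, {for o, continuous (fun x => G x i j)}) ->
  (forall v, v != 0 -> 0 < quadratic_form (G o) v) ->
  exists c C : R, [/\ 0 < c, 0 < C & \forall x \near o, forall v,
    c * `|v| ^+ 2 <= quadratic_form (G x) v <= C * `|v| ^+ 2].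
Proof.
move=> cG G_gt0.
have [c c0 cP] := sphere_lower_bound (@quadratic_form_continuous (G o)) G_gt0.
have {}cP v : c * `|v| ^+ 2 <= quadratic_form (G o) v.
  have [->|v0] := eqVneq v 0.
    rewrite normr0 expr0n mulr0 -(scale0r (0 : 'rV[R]_n)) quadratic_formZ.
    by rewrite expr0n mul0r.
  have nv : 0 < `|v| by rewrite normr_gt0.
  have := cP (`|v|^-1 *: v);
    rewrite normrZ normfV normr_id mulVf ?gt_eqF // => /(_ erefl).
  by rewrite quadratic_formZ exprVn mulrC ler_pdivlMr // exprn_gt0.
pose B := \sum_i \sum_j `|G o i j|.
have B0 : 0 <= B by apply: sumr_ge0 => i _; apply: sumr_ge0.
exists (c / 2), (B + c / 2); split;
  [by rewrite divr_gt0|by rewrite ltr_wpDl // divr_gt0|].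
(* There are [n ^ 2] coefficients, so their total change is at most [c / 2]. *)
pose e := c / 2 / (n.+1%:R ^+ 2).
have e0 : 0 < e by rewrite !divr_gt0 // exprn_gt0.
have nG : \forall x \near o, forall i j, `|G o i j - G x i j| <= e.
  apply: (@filter_forall _ _ _ _ (nbhs_filter o)) => i.
  apply: (@filter_forall _ _ _ _ (nbhs_filter o)) => j.
  by have /cvgrPdist_le /(_ e e0) := cG i j.
apply: filterS nG => x xe v.
have : `|quadratic_form (G o) v - quadratic_form (G x) v| <= c / 2 * `|v| ^+ 2.
  rewrite -quadratic_formB; apply: le_trans (quadratic_form_le _ _) _.
  rewrite ler_wpM2r ?exprn_ge0 //.
  apply: (@le_trans _ _ (\sum_(i < n) \sum_(j < n) e)).
    by apply: ler_sum => i _; apply: ler_sum => j _; exact: xe.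
  rewrite !sumr_const !card_ord -mulrnA -[e *+ _]mulr_natl natrM /e mulrA.
  rewrite ler_pdivrMr ?exprn_gt0 // mulrC ler_wpM2l ?divr_ge0 ?(ltW c0) //.
  by rewrite -expr2 ler_pXn2r ?nnegrE // ler_nat.
have := quadratic_form_le (G o) v; rewrite -/B.
have := cP v; rewrite !ler_norml => H1 /andP[H2 H3] /andP[H4 H5].
by apply/andP; split; lra.
Qed.

End QuadraticForm.

(** * Riemannian metrics and velocities in a chart *)

Section Charts.
Context {R : realType} (M : manifold R).
Implicit Types (a b : midx M) (g : riemannian_metric M).

Local Notation E := 'rV[R]_(mdim M).

Lemma chart_preimage_open a (W : set M) : open W ->
  open [set x | cimg (mchart a) x /\ W (cinv (mchart a) x)].
Proof.
move=> oW; rewrite openE => x [xi Wx] /=; rewrite /interior.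
have n1 : nbhs x (cimg (mchart a)).
  by apply: open_nbhs_nbhs; split; [exact: cimg_open|].
have n2 : nbhs x (cinv (mchart a) @^-1` W).
  by apply: (cinv_continuous xi); apply: open_nbhs_nbhs.
exact: filterI n1 n2.
Qed.

Lemma fm0 (V : vbundle M) (g : fibre_metric V) (p : M) (w : V p) :
  fm g p 0 w = 0.
Proof.
by have := fm_linear g (-1) w w w; rewrite scaleN1r addNr mulN1r addNr.
Qed.

Lemma fm_sum (V : vbundle M) (g : fibre_metric V) (p : M) n (s : 'I_n -> R)
    (u : 'I_n -> V p) (w : V p) :
  fm g p (\sum_i s i *: u i) w = \sum_i s i * fm g p (u i) w.
Proof.
elim: n s u => [|n IH] s u; first by rewrite !big_ord0 fm0.
by rewrite !big_ord_recl fm_linear IH.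
Qed.

Definition chart_speed g a (x v : E) : R :=
  Num.sqrt (fm g (cinv (mchart a) x)
    (tvect a (cinv (mchart a) x) v) (tvect a (cinv (mchart a) x) v)).

Definition chart_coef g a (x : E) (i j : 'I_(mdim M)) : R :=
  fm g (cinv (mchart a) x)
    (tvect a (cinv (mchart a) x) (delta_mx 0 i))
    (tvect a (cinv (mchart a) x) (delta_mx 0 j)).

Lemma chart_coefE g a (x v : E) :
  fm g (cinv (mchart a) x)
    (tvect a (cinv (mchart a) x) v) (tvect a (cinv (mchart a) x) v) =
  quadratic_form (chart_coef g a x) v.
Proof.
rewrite [in LHS](row_sum_delta v) linear_sum.
under eq_bigr do rewrite linearZ.
rewrite fm_sum; apply: eq_bigr => i _.
rewrite fm_sym fm_sum mulr_sumr; apply: eq_bigr => j _.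
by rewrite mulrA fm_sym.
Qed.

(** The metric in coordinates is a continuous family of quadratic forms, positive definite at [o]
    because [tvect] is inverted by [tcoord]. Taking square roots in the bounds for such families
    makes the Riemannian and coordinate norms comparable near [o]. *)
Lemma chart_speed_bounds g a (o : E) : cimg (mchart a) o ->
  exists c C r : R, [/\ 0 < c, 0 < C, 0 < r & forall x, `|o - x| < r ->
    cimg (mchart a) x /\
    forall v, c * `|v| <= chart_speed g a x v <= C * `|v|].
Proof.
move=> oi.
have cG i j : {for o, continuous (fun x => chart_coef g a x i j)}.
  have sm := @fm_smooth _ _ _ g a (delta_mx 0 i) (delta_mx 0 j) a 0.
  by apply: sm; split=> //; exact: cinv_dom.
have G_gt0 v : v != 0 -> 0 < quadratic_form (chart_coef g a o) v.
  move=> v0; rewrite -chart_coefE; apply: fm_pos; apply/eqP => tv0.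
  have K : tcoord a (cinv (mchart a) o) (tvect a (cinv (mchart a) o) v) = v :=
    @vb_invK _ _ (tangent_bundle M) a _ (cinv_dom oi) v.
  have Z : tcoord a (cinv (mchart a) o) 0 = 0 := linear0 _.
  by move: v0; rewrite -K (congr1 (tcoord a (cinv (mchart a) o)) tv0) Z eqxx.
have [c [C [c0 C0 near_o]]] := quadratic_form_bounds cG G_gt0.
have no : \forall x \near o, cimg (mchart a) x.
  by apply: open_nbhs_nbhs; split; [exact: cimg_open|].
have [r /= r0 Hr] := (nbhs_normP _ _).1 (filterI no near_o).
exists (Num.sqrt c), (Num.sqrt C), r; split; rewrite ?sqrtr_gt0 // => x xr.
have [xi Hx] := Hr x xr; split=> // v.
have sq (s : R) : 0 < s -> Num.sqrt s * `|v| = Num.sqrt (s * `|v| ^+ 2).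
  by move=> s0; rewrite sqrtrM ?ltW // sqrtr_sqr normr_id.
have /andP[H1 H2] := Hx v.
by rewrite /chart_speed chart_coefE !sq // !ler_wsqrtr.
Qed.

(** [velocity] uses the preferred chart at [c t], which changes with [t]. The chain rule for the
    transition map expresses it through the fixed chart [b]. *)
Lemma velocity_chart b (c : R -> M) (t : R) (w : E) :
  cdom (mchart b) (c t) -> {for t, continuous c} ->
  is_derive t 1 (cmap (mchart b) \o c) w ->
  velocity c t = tvect b (c t) w.
Proof.
move=> bt ct dw; rewrite /velocity derive1E.
set b' := chart_at (c t).
have dtr := transition_differentiable bt (chart_atP (c t)).
have := is_derive_diff_comp dw dtr; rewrite -/b' => -[_ <-].
apply: near_eq_derive.
have : \forall s \near t, cdom (mchart b) (c s).
  by apply: ct; apply: open_nbhs_nbhs; split; [exact: cdom_open|].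
by apply: filterS => s sb; rewrite /transition /= cmapK.
Qed.

End Charts.

(** * Upper bound for the Riemannian distance by straight segments in a chart *)

Lemma Ck_id (R : realType) k (U : set R^o) : Ck_on k U (fun t : R^o => t : R^o).
Proof.
case: k => [|k] /=; first by move=> x _; exact: id.
split=> [x _|v]; first exact/derivable1_diffP/derivable_id.
have -> : (fun x : R^o => 'D_v (fun t : R^o => t : R^o) x) = fun=> v.
  by apply/funext => x; exact: derive_id.
exact: Ck_cst.
Qed.

Lemma smooth_line (R : realType) (V : normedModType R) (U : set R^o) (u v : V) :
  open U -> smooth_on U (fun t : R^o => t *: v + u).
Proof.
by move=> oU k; apply: Ck_add => //;
  [apply: Ck_scale_cst (Ck_id _ _) => //|exact: Ck_cst].
Qed.

Lemma open_enlarged_unit (R : realType) (e : R) :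
  open [set t : R | - e < t < 1 + e].
Proof.
have -> : [set t : R | - e < t < 1 + e] = `]- e, 1 + e[%classic.
  by apply/seteqP; split => t; rewrite /= in_itv.
exact: interval_open.
Qed.

Section DistanceUpperBound.
Context {R : realType} (M : manifold R) (g : riemannian_metric M).
Variables (a : midx M) (o : 'rV[R]_(mdim M)).
Hypothesis o_img : cimg (mchart a) o.

Lemma riemannian_distance_chart_le : exists C r : R, [/\ 0 < C, 0 < r &
  forall x y, `|o - x| < r -> `|o - y| < r ->
    (riemannian_distance g (cinv (mchart a) x) (cinv (mchart a) y)
      <= (C * `|x - y|)%:E)%E].
Proof.
have [c0 [C [r [_ C0 r0 bnd]]]] := chart_speed_bounds g o_img.
(* The segment is prolonged to parameters in (-1/2, 3/2), where its distance to [o] stays below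
   [r / 4 + 3 / 2 * (r / 2) = r]. *)
exists C, (r / 4); split=> //; first by rewrite divr_gt0.
move=> x y xr yr.
pose z (t : R) := t *: (y - x) + x; pose c (t : R) := cinv (mchart a) (z t).
pose e : R := 1 / 2.
have zr (t : R) : - e < t < 1 + e -> `|o - z t| < r.
  move=> /andP[t0 t1]; rewrite (_ : o - z t = (o - x) - t *: (y - x));
    last first.
    by rewrite /z opprD addrA addrAC.
  apply: le_lt_trans (ler_normB _ _) _; rewrite normrZ.
  have yx : `|y - x| <= r / 2.
    rewrite (_ : y - x = (o - x) - (o - y));
      last by rewrite opprB [RHS]addrC addrA subrK.
    by apply: le_trans (ler_normB _ _) _; lra.
  have t2 : `|t| <= 3 / 2 by rewrite ler_norml /e in t0 t1 *; lra.
  have : `|t| * `|y - x| <= 3 / 2 * (r / 2) by rewrite ler_pM.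
  by lra.
have zi t : - e < t < 1 + e -> cimg (mchart a) (z t) by move=> /zr/bnd[].
have cz t : {for t, continuous z}.
  have [dz _] := is_derive_line x (y - x) t.
  exact: differentiable_continuous ((derivable1_diffP _ _).1 dz).
have cc t : - e < t < 1 + e -> {for t, continuous c}.
  move=> ti; apply: (@continuous_comp _ _ _ z (cinv (mchart a))) => //.
  exact: cinv_continuous (zi t ti).
have c_arc : smooth_arc c.
  exists e; first by rewrite /e; lra.
  split=> // b; set T := [set t | _].
  pose T' := [set x | cimg (mchart a) x /\ cdom (mchart b) (cinv (mchart a) x)].
  have oT' : open T' by apply: chart_preimage_open; exact: cdom_open.
  (* Openness of [T] is read off from [z], which is continuous on the whole line, whereas [c] is
     controlled only while [z] stays in the chart. *)
  have TE : T = [set t : R | - e < t < 1 + e] `&` z @^-1` T'.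
    apply/seteqP; split => t; first by case=> ti tb; split=> //; split=> //;
      exact: zi.
    by case=> ti [].
  have oT : @open R^o T.
    rewrite TE; apply: openI; first exact: open_enlarged_unit.
    by apply: open_comp oT' => t _; exact: cz.
  apply: (@smooth_comp R R^o _ _ T T' z (transition a b)) => //.
  - by move=> t [ti tb]; split=> //; exact: zi.
  - exact: smooth_line.
  - exact: mcompat.
apply: ge_ereal_inf; exists (curve_length g [:: c]).
  exists [:: c] => //=; split=> //; first by rewrite /c /z scale0r add0r.
  by rewrite /c /z scale1r subrK.
rewrite /curve_length big_seq1 /arc_length;
  apply: integral_speed_le => t /andP[t0 t1].
have ti : - e < t < 1 + e by rewrite /e; apply/andP; split; lra.
rewrite sqrtr_ge0 /= distrC.
have dcz : is_derive t 1 (cmap (mchart a) \o c) (y - x).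
  have [dz dzE] := is_derive_line x (y - x) t.
  have nz : \forall s \near t, z s = (cmap (mchart a) \o c) s.
    have oI := @open_enlarged_unit R e.
    by apply: filterS (open_nbhs_nbhs (conj oI ti)) => s /zi si;
      rewrite /c /= cinvK.
  apply: DeriveDef; last by rewrite -(near_eq_derive _ nz).
  apply/derivable1_diffP; apply: near_eq_differentiable nz _.
  exact/derivable1_diffP.
rewrite (velocity_chart (cinv_dom (zi _ ti)) (cc _ ti) dcz).
by have [_ /(_ (y - x)) /andP[_]] := bnd _ (zr _ ti).
Qed.

End DistanceUpperBound.

(** * Lower bound for the Riemannian distance by cutoff coordinate functions *)

Section DistanceLowerBound.
Context {R : realType} (M : manifold R) (g : riemannian_metric M).
Variables (b : midx M) (o : 'rV[R]_(mdim M)) (c rho r : R).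
Hypotheses (c_gt0 : 0 < c) (r_gt0 : 0 < r) (r_rho : r < rho).
Hypothesis speed_ge : forall x, `|o - x| < rho -> cimg (mchart b) x /\
  forall v, c * `|v| <= chart_speed g b x v.

(** The constant of [dbump_coord_le], divided by [c] to replace the coordinate norm by the
    Riemannian one. *)
Let K1 : R := (8 * (mdim M)%:R + 1) * r ^+ 4 / c.

Let K1_gt0 : 0 < K1.
Proof.
by rewrite divr_gt0 // mulr_gt0 ?exprn_gt0 // ltr_wpDl // mulr_ge0.
Qed.

Definition global_bump (a : R) (i : 'I_(mdim M)) (q : M) : R :=
  if `[< cdom (mchart b) q >] then bump_coord o r a i (cmap (mchart b) q)
  else 0.

Lemma sqgap_norm x : 0 <= sqgap o r x -> `|o - x| < rho.
Proof.
move=> x0; apply: le_lt_trans r_rho; apply: ler_norm_coord => [|i];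
  first exact: ltW.
by rewrite !mxE distrC; exact: sqgap_gt0_coord.
Qed.

Let bump_support : set M := cinv (mchart b) @` [set x | 0 <= sqgap o r x].

(** The closed ball is compact and lies in the chart image, so its image in the Hausdorff space [M]
    is compact, hence closed. Consequently the bump vanishes near every point outside the chart
    domain. *)
Let closed_bump_support : closed bump_support.
Proof.
apply: compact_closed; first exact: mhausdorff.
apply: continuous_compact.
  apply: continuous_in_subspaceT => x;
    rewrite inE => /sqgap_norm/speed_ge[xi _].
  exact: cinv_continuous.
apply: bounded_closed_compact; last first.
  apply: (@closed_comp _ _ (sqgap o r) [set x | 0 <= x]); last exact: closed_ge.
  by move=> x _; exact: sqgap_continuous.
exists (`|o| + rho); split; first exact: num_real.
move=> B hB x /sqgap_norm ox; apply: ltW; apply: le_lt_trans hB.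
rewrite -[x in `|x|](subKr o); apply: le_trans (ler_normB _ _) _.
by rewrite lerD2l ltW.
Qed.

Lemma global_bump_out a i q : ~ bump_support q -> global_bump a i q = 0.
Proof.
move=> nq; rewrite /global_bump; case: asboolP => // qb.
have q0 : sqgap o r (cmap (mchart b) q) < 0.
  rewrite ltNge; apply/negP => q0; apply: nq.
  by exists (cmap (mchart b) q) => //; rewrite cmapK.
by rewrite /bump_coord max_l ?ltW // expr0n mul0r.
Qed.

Lemma chart_speedE q v : cdom (mchart b) q ->
  chart_speed g b (cmap (mchart b) q) v =
  Num.sqrt (fm g q (tvect b q v) (tvect b q v)).
Proof. by move=> qb; rewrite /chart_speed cmapK. Qed.

(** Along the arc the bump is C^1: inside the chart by the chain rule, and outside because it
    vanishes locally. Its derivative is at most [K1] times the speed, and integration gives the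
    bound even if the arc leaves the chart. *)
Lemma global_bump_arc_length a i (gam : R -> M) :
  `|o 0 i - a| <= r -> smooth_arc gam ->
  (`|global_bump a i (gam 1) - global_bump a i (gam 0)|%:E
    <= K1%:E * arc_length g gam)%E.
Proof.
move=> oa [e e0 [gam_cont gam_smooth]].
pose I := [set t : R | - e < t < 1 + e].
have oI : open I := @open_enlarged_unit R e.
pose y : R -> 'rV[R]_(mdim M) := cmap (mchart b) \o gam.
pose y' (t : R) : 'rV[R]_(mdim M) := 'D_1 y t.
pose H := global_bump a i \o gam.
have inside t : I t -> cdom (mchart b) (gam t) ->
    [/\ is_derive t 1 y (y' t), {for t, continuous y'} &
        \forall s \near t, I s /\ cdom (mchart b) (gam s)].
  move=> ti tb; have [dy Dy] := gam_smooth b 1%N.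
  split.
  - have dyt := dy t (conj ti tb).
    by apply: DeriveDef => //; exact: diff_derivable dyt.
  - by have := Dy 1 t (conj ti tb).
  - have nI : \forall s \near t, I s by exact: open_nbhs_nbhs.
    have nb : \forall s \near t, cdom (mchart b) (gam s).
      have ob := cdom_open (mchart b).
      exact: (gam_cont t ti _ (open_nbhs_nbhs (conj ob tb))).
    exact: (filterI nI nb).
have dH_inside t : I t -> cdom (mchart b) (gam t) ->
    is_derive t 1 H (dbump_coord o r a i (y t) (y' t)).
  move=> ti tb; have [dy _ near_t] := inside t ti tb.
  have [db dbE] := is_derive_bump_coord o r a i dy.
  have HE : \forall s \near t, bump_coord o r a i (y s) = H s.
    apply: filterS near_t => s [_ sb]; rewrite /H /= /global_bump.
    by case: asboolP.
  apply: DeriveDef; last by rewrite -(near_eq_derive _ HE).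
  by apply/derivable1_diffP; apply: near_eq_differentiable HE _;
    exact/derivable1_diffP.
have H_outside t : I t -> ~ cdom (mchart b) (gam t) ->
    \forall s \near t, 0 = H s.
  move=> ti tb.
  have nt : ~ bump_support (gam t).
    by move=> [x /sqgap_norm/speed_ge[xi _] xt]; apply: tb; rewrite -xt;
      exact: cinv_dom.
  have : \forall s \near t, ~ bump_support (gam s).
    have oC := closed_openC closed_bump_support.
    exact: (gam_cont t ti _ (open_nbhs_nbhs (conj oC nt))).
  by apply: filterS => s hs; apply: esym; exact: global_bump_out hs.
have dH_outside t : (\forall s \near t, 0 = H s) -> is_derive t 1 H 0.
  move=> HE; have [dc dcE] := is_derive_cst (0 : R) t 1.
  apply: DeriveDef; last by rewrite -(near_eq_derive _ HE).
  by apply/derivable1_diffP; apply: near_eq_differentiable HE _;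
    exact/derivable1_diffP.
apply: (@integral_speed_bound R H _ e) => //.
- move=> t ti; have [tb|tb] := pselect (cdom (mchart b) (gam t)).
    by have [] := dH_inside t ti tb.
  by have [] := dH_outside t (H_outside t ti tb).
- move=> t ti; have [tb|tb] := pselect (cdom (mchart b) (gam t)).
    have [dy cy' near_t] := inside t ti tb.
    have cy : {for t, continuous y}.
      have [dy' _] := dy.
      exact: differentiable_continuous ((derivable1_diffP _ _).1 dy').
    have HE : \forall s \near t, dbump_coord o r a i (y s) (y' s) = derive1 H s.
      apply: filterS near_t => s [si sb]; rewrite derive1E.
      by have [_ ->] := dH_inside s si sb.
    have cd : (fun s => dbump_coord o r a i (y s) (y' s)) @ t --> derive1 H t.
      rewrite -(nbhs_singleton HE).
      exact: (@dbump_coord_continuous _ _ o r a i y y' t cy cy').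
    exact: (cvg_trans (near_eq_cvg HE) cd).
  (* Continuity of the derivative at [t] requires it to vanish near [t], so [H] must be locally zero
     at nearby times too. *)
  have near_t := nbhs_interior (H_outside t ti tb).
  have HE : \forall s \near t, 0 = derive1 H s.
    by apply: filterS near_t => s /dH_outside[_ dE]; rewrite derive1E dE.
  have c0 : (fun _ : R => 0 : R) @ t --> derive1 H t.
    by rewrite -(nbhs_singleton HE); exact: cvg_cst.
  exact: (cvg_trans (near_eq_cvg HE) c0).
move=> t t01.
have ti : I t by move: t01 => /andP[? ?]; apply/andP; split; lra.
rewrite derive1E; have [tb|tb] := pselect (cdom (mchart b) (gam t)); last first.
  have [_ ->] := dH_outside t (H_outside t ti tb).
  by rewrite normr0 mulr_ge0 ?sqrtr_ge0 // ltW.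
have [_ ->] := dH_inside t ti tb.
have [dy _ _] := inside t ti tb.
rewrite (velocity_chart tb (gam_cont t ti) dy) -chart_speedE //.
(* The lower bound on the speed is available only near [o]; off the ball the differential of the
   bump is zero. *)
have [s0|s0] := leP (sqgap o r (y t)) 0.
  by rewrite dbump_coord_out // normr0 mulr_ge0 ?sqrtr_ge0 // ltW.
apply: le_trans (dbump_coord_le _ _ r_gt0 oa) _.
rewrite /K1 -[X in _ <= X]mulrA ler_wpM2l //.
  by rewrite mulr_ge0 ?exprn_ge0 ?(ltW r_gt0) // addr_ge0 // mulr_ge0.
rewrite ler_pdivlMl //.
by have [_ ] := speed_ge (sqgap_norm (ltW s0)).
Qed.

Lemma curve_length_ge0 s : (0 <= curve_length g s)%E.
Proof.
apply: sume_ge0 => gam _; apply: integral_ge0 => t _.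
by rewrite lee_fin sqrtr_ge0.
Qed.

Lemma global_bump_curve_length a i p s q :
  `|o 0 i - a| <= r -> piecewise_smooth p s q ->
  (`|global_bump a i q - global_bump a i p|%:E <= K1%:E * curve_length g s)%E.
Proof.
move=> oa; elim: s p => [|gam s IH] p /=.
  by move=> ->; rewrite subrr normr0 /curve_length big_nil mule0.
move=> [gam_arc <- /IH {}IH]; rewrite /curve_length big_cons.
rewrite ge0_muleDr; first last.
- exact: curve_length_ge0.
- by apply: integral_ge0 => t _; rewrite lee_fin sqrtr_ge0.
apply: le_trans (leeD (global_bump_arc_length oa gam_arc) IH).
rewrite -EFinD lee_fin [X in _ <= X]addrC.
rewrite (_ : global_bump a i q - _ =
  (global_bump a i q - global_bump a i (gam 1)) +
  (global_bump a i (gam 1) - global_bump a i (gam 0))) ?ler_normD //.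
by rewrite addrA subrK.
Qed.

(** Let [i] be a coordinate where the norm of [x - y] is attained, and take [a = x 0 i]. The bump
    vanishes at [x], and at [y] it has absolute value at least [(r ^+ 2 / 2) ^+ 2 * |x - y|], since
    the gap there is at least [r ^+ 2 / 2]. Every chain of arcs between the two points is then long
    enough. *)
Lemma riemannian_distance_bump_ge x y : `|o - x| < r / (2 * (mdim M).+1%:R) ->
  `|o - y| < r / (2 * (mdim M).+1%:R) ->
  (`|x - y|%:E <= (K1 / (r ^+ 2 / 2) ^+ 2)%:E *
    riemannian_distance g (cinv (mchart b) x) (cinv (mchart b) y))%E.
Proof.
set n := mdim M; set d := r / _; move=> xd yd.
have d0 : 0 < d by rewrite divr_gt0 // mulr_gt0.
have n1 : 1 <= n.+1%:R :> R by rewrite ler1n.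
have d_r : d < r by rewrite ltr_pdivrMr ?mulr_gt0 // ltr_pMr //; lra.
set kap := (r ^+ 2 / 2) ^+ 2.
have kap0 : 0 < kap by rewrite exprn_gt0 // divr_gt0 // exprn_gt0.
have K0 : 0 < K1 / kap by rewrite divr_gt0.
have img z : `|o - z| < d -> cimg (mchart b) z.
  by move=> zd; have [] := @speed_ge z _;
    first by apply: lt_trans zd (lt_trans d_r _).
rewrite -lee_pdivrMl //; apply: le_ereal_inf_tmp => _ [s /= ps <-].
rewrite lee_pdivrMl //.
have [xy0|/mx_norm_neq0[[j i]]] := eqVneq (mx_norm (x - y)) 0.
  rewrite [`|_|]xy0; apply: mule_ge0; last exact: curve_length_ge0.
  by rewrite lee_fin ltW.
rewrite ord1 /= -[mx_norm _]/(`|x - y|) => ->.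
have oa : `|o 0 i - x 0 i| <= r.
  by have := ler_coord_norm (o - x) i; rewrite !mxE => h;
    apply: le_trans h (ltW (lt_trans xd d_r)).
(* With [n.+1 * d = r / 2], the squared Euclidean distance of [y] to [o] is at most
   [n.+1 * d ^+ 2 = r / 2 * d <= r ^+ 2 / 2]. *)
have gap_ge : r ^+ 2 / 2 <= sqgap o r y.
  have Nd : n.+1%:R * d = r / 2.
    by rewrite /d mulrC invfM mulrA mulrVK ?unitfE ?gt_eqF //
      (lt_le_trans _ n1).
  have sum_le : \sum_(j < n) (y 0 j - o 0 j) ^+ 2 <= n.+1%:R * d ^+ 2.
    apply: (@le_trans _ _ (\sum_(j < n) d ^+ 2)); last first.
      rewrite sumr_const card_ord -[d ^+ 2 *+ _]mulr_natl.
      by rewrite ler_wpM2r ?sqr_ge0 // ler_nat.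
    apply: ler_sum => k _; rewrite -real_normK ?num_real //
      ler_pXn2r ?nnegrE ?(ltW d0) //.
    have := ler_coord_norm (o - y) k; rewrite !mxE distrC => h.
    by apply: le_trans h (ltW yd).
  rewrite /sqgap; move: sum_le;
    rewrite [in X in _ <= X]expr2 mulrA Nd => sum_le.
  have : r / 2 * d <= r / 2 * r by rewrite ler_pM2l ?divr_gt0 // ltW.
  by rewrite expr2; lra.
have gap_gt0 : 0 < sqgap o r y by apply: lt_le_trans gap_ge;
  rewrite divr_gt0 // exprn_gt0.
have := global_bump_curve_length oa ps.
rewrite /global_bump !asboolT; [|exact/cinv_dom/img..].
rewrite !cinvK; [|exact: img..].
rewrite /bump_coord subrr mulr0 subr0 => le_len.
rewrite (_ : K1 / kap = kap^-1 * K1); last by rewrite mulrC.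
rewrite EFinM -muleA lee_pdivlMl //; apply: le_trans le_len;
  rewrite -EFinM lee_fin normrM.
have -> : `|(x - y) 0 i| = `|y 0 i - x 0 i| by rewrite !mxE distrC.
apply: ler_wpM2r => //.
rewrite max_r ?(ltW gap_gt0) // ger0_norm ?sqr_ge0 //.
by rewrite ler_pXn2r ?nnegrE ?(ltW gap_gt0) // divr_ge0 // sqr_ge0.
Qed.

End DistanceLowerBound.

Lemma near_dist_lt (R : realType) (V : normedModType R) (o : V) (r : R) :
  0 < r -> \forall x \near o, `|o - x| < r.
Proof.
move=> r0; have ido : {for o, continuous (@id V)} by exact: id.
by have /cvgrPdist_lt /(_ r r0) := ido.
Qed.

Lemma riemannian_distance_chart_ge (R : realType) (M : manifold R)
    (g : riemannian_metric M) (b : midx M) (o : 'rV[R]_(mdim M)) :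
  cimg (mchart b) o ->
  exists K r : R, [/\ 0 < K, 0 < r & forall x y, `|o - x| < r -> `|o - y| < r ->
    (`|x - y|%:E <= K%:E *
      riemannian_distance g (cinv (mchart b) x) (cinv (mchart b) y))%E].
Proof.
move=> oi; have [c [C [rho [c0 C0 rho0 bnd]]]] := chart_speed_bounds g oi.
pose r := rho / 2; have r0 : 0 < r by rewrite divr_gt0.
have r_rho : r < rho by rewrite /r; lra.
have speed x : `|o - x| < rho -> cimg (mchart b) x /\
    forall v, c * `|v| <= chart_speed g b x v.
  by move=> /bnd[xi xv]; split=> // v; have /andP[] := xv v.
exists ((8 * (mdim M)%:R + 1) * r ^+ 4 / c / (r ^+ 2 / 2) ^+ 2),
  (r / (2 * (mdim M).+1%:R)); split.
- have n0 : 0 < 8 * (mdim M)%:R + 1 :> R by rewrite ltr_wpDl // mulr_ge0.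
  by rewrite !(divr_gt0, mulr_gt0, exprn_gt0).
- by rewrite divr_gt0 // mulr_gt0.
- exact: (riemannian_distance_bump_ge c0 r0 r_rho speed).
Qed.

(** * Combination of the three estimates in the charts at [p] and [Theta p] *)

Theorem theorem3p6 (R : realType)
  (* any normalization convention: the theorem holds for each of them *)
  (S M : manifold R) (normalized : riemannian_metric M -> Prop)
  (g : S -> riemannian_metric M)
  (g_smooth : smooth_family g)
  (g_einstein : forall p : S, einstein (g p))
  (g_normalized : forall p : S, normalized (g p))
  (Z : vbundle S) (hZ : fibre_metric Z)
  (Rm : forall p : S, {linear tangent_bundle S p -> Z p})
  (Rm_smooth : smooth_morphism (f := idfun) (g := idfun) [set: S] Rm)
  (* [Theta] and [Psi] are only used on [U]; their other values are irrelevant *)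
  (U : set S) (U_open : open U)
  (N : manifold R) (hN : riemannian_metric N)
  (Theta : S -> N) (Theta_smooth : smooth_map U Theta)
  (Psi : forall p : S, {linear Z p -> tangent_bundle N (Theta p)})
  (Psi_iso : vb_isomorphism (g := Theta) U Psi)
  (Psi_R : forall p : S, U p -> forall X : tangent_bundle S p,
     Psi p (Rm p X) = dmap Theta p X)
  (p : S) (Up : U p)
  (gR_pos : forall X : tangent_bundle S p, X != 0 ->
     0 < response_metric hZ Rm X X)
  (gS : riemannian_metric S) (gN : riemannian_metric N) :
  exists U0 : set S, [/\ nbhs p U0, U0 `<=` U &
    exists C : R, 0 < C /\ forall p1 p2 : S, U0 p1 -> U0 p2 ->
      (riemannian_distance gS p1 p2
        <= C%:E * riemannian_distance gN (Theta p1) (Theta p2))%E].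
Proof.
pose a := chart_at p; pose b := chart_at (Theta p).
pose o := cmap (mchart a) p.
have pa : cdom (mchart a) p := chart_atP p.
have qb : cdom (mchart b) (Theta p) := chart_atP (Theta p).
have oK : cinv (mchart a) o = p by exact: cmapK.
pose f := cmap (mchart b) \o Theta \o cinv (mchart a).
pose D := [set x | [/\ cimg (mchart a) x, U (cinv (mchart a) x) &
  cdom (mchart b) (Theta (cinv (mchart a) x))]].
have [cTheta sTheta] := Theta_smooth.
have D_open : open D.
  have oW : open [set q | U q /\ cdom (mchart b) (Theta q)].
    rewrite openE => q [Uq bq]; rewrite /interior.
    have n1 : nbhs q U by exact: open_nbhs_nbhs.
    have n2 : nbhs q (Theta @^-1` cdom (mchart b)).
      exact: (cTheta q Uq _ (open_nbhs_nbhs (conj (cdom_open (mchart b)) bq))).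
    exact: (filterI n1 n2).
  have -> : D = [set x | cimg (mchart a) x /\
      [set q | U q /\ cdom (mchart b) (Theta q)] (cinv (mchart a) x)].
    by apply/seteqP; split => x; [case|case=> xi []].
  exact: chart_preimage_open.
have Do : D o by split; rewrite ?oK //; exact: cmap_img.
have f_C1 : Ck_on 1 D f := sTheta a b 1%N.
have f_inj v : v != 0 -> 'd f o v != 0.
  move=> v0; apply/eqP => fv0.
  have gRv := gR_pos v v0.
  have [_ [L' [_ /(_ p Up)[PsiK _]]]] := Psi_iso.
  have Rv0 : Rm p v = 0.
    (* As [a] and [b] are the preferred charts, [dmap Theta p v] is by definition ['d f o v]. *)
    by rewrite -(PsiK (Rm p v)) Psi_R // (fv0 : dmap Theta p v = 0) linear0.
  by move: gRv; rewrite /response_metric Rv0 fm0 ltxx.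
have [c1 [r1 [c1_gt0 r1_gt0 f_lower]]] :=
  immersion_lower_lipschitz D_open f_C1 Do f_inj.
have [C2 [r2 [C2_gt0 r2_gt0 dS_le]]] :=
  riemannian_distance_chart_le gS (cmap_img pa).
have [K [r3 [K_gt0 r3_gt0 dN_ge]]] :=
  riemannian_distance_chart_ge gN (cmap_img qb).
have fo : f o = cmap (mchart b) (Theta p) by rewrite /f /= oK.
(* The three radii make the lower Lipschitz bound for [f], the upper bound on the source and the
   lower bound on the target all applicable. *)
pose V := [set x | [/\ `|o - x| < r1, `|o - x| < r2 & `|f o - f x| < r3]].
have nV : nbhs o V.
  have n1 : nbhs o [set x | `|o - x| < r1].
    exact: (@near_dist_lt R 'rV[R]_(mdim S) o r1).
  have n2 : nbhs o [set x | `|o - x| < r2].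
    exact: (@near_dist_lt R 'rV[R]_(mdim S) o r2).
  have n3 : nbhs o [set x | `|f o - f x| < r3].
    have f_cont : {for o, continuous f} := Ck_cont f_C1 Do.
    by have /cvgrPdist_lt /(_ r3 r3_gt0) := f_cont.
  by apply: filterS (filterI n1 (filterI n2 n3)) => x [? []].
pose U0 := cdom (mchart a) `&` cmap (mchart a) @^-1` V.
have U0P q : U0 q -> exists x,
    [/\ V x, D x, q = cinv (mchart a) x & Theta q = cinv (mchart b) (f x)].
  move=> [qa Vq]; exists (cmap (mchart a) q).
  (* The bound is applied to a point paired with itself, to learn that this point lies in [D]. *)
  have [q1 _ _] := Vq; have [Dq _ _] := f_lower _ _ q1 q1.
  have [_ _] := Dq; rewrite /f /= cmapK // => qb'.
  by split=> //; rewrite cmapK.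
exists U0; split.
- have n1 : nbhs p (cdom (mchart a)).
    by apply: open_nbhs_nbhs; split; [exact: cdom_open|].
  have n2 : nbhs p (cmap (mchart a) @^-1` V) := cmap_continuous pa nV.
  exact: (filterI n1 n2).
- by move=> q /U0P[x [_ [_ Ux _] -> _]].
(* The source distance is at most [C2 * |x - y|], then [C2 / c1 * |f x - f y|], then [C2 / c1 * K]
   times the target distance. *)
- exists (C2 / c1 * K); split; first by rewrite mulr_gt0 ?divr_gt0.
  move=> p1 p2 /U0P[x [[x1 x2 x3] _ -> ->]] /U0P[y [[y1 y2 y3] _ -> ->]].
  have [_ _ fxy] := f_lower x y x1 y1.
  apply: le_trans (dS_le x y x2 y2) _.
  rewrite fo in x3 y3.
  apply: (@le_trans _ _ (C2 / c1 * `|f x - f y|)%:E); last first.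
    rewrite (EFinM (C2 / c1) K) (EFinM (C2 / c1)) -muleA.
    apply: lee_wpmul2l; first by rewrite lee_fin divr_ge0 // ltW.
    exact: dN_ge (f x) (f y) x3 y3.
  by rewrite lee_fin -mulrA ler_wpM2l ?(ltW C2_gt0) // ler_pdivlMl.
Qed.
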